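(* Let $(H,\mathcal B,\mu_1)$ be an abelian normalizable hypergroup such that its dual $\widehat{(H,\mathcal B,\mu_1)}$ is RN (real non-negative). Then $(H,\mathcal B)$ is Burnside if and only if the following identity holds in $\widehat{(H,\mathcal B)}$: $$\Big(\prod_{j=1}^m\mu_j\Big)^2=\frac{1}{n\big(\widehat{(H,\mathcal B)}_{ad}\big)}\Big(\sum_{\mu_j\in\widehat{\mathcal B}_{ad}}\widehat h_j\,\mu_j\Big).$$
   Context: Hypergroup: a finite-dimensional unital associative $\mathbb C$-algebra $H$ with a $\mathbb C$-basis $\mathcal B=\{x_1=1,\dots,x_m\}$, $x_ix_j=\sum_kN_{i,j}^kx_k$, $N_{i,j}^k\in\mathbb C$, and an involution $i\mapsto i^*$ of $\mathcal I=\{1,\dots,m\}$ such that $N_{i,i^*}^1>0$ and $N_{i,j}^1=0$ if $j\ne i^*$. Standing assumption: the involution $x_i\mapsto x_i^*:=x_{i^*}$ extends (conjugate-linearly) to an anti-involution of $H$, i.e. $N_{j^*,i^*}^{k^*}=\overline{N_{i,j}^k}$, so $H$ is a $*$-algebra (hence semisimple), and if $H$ is commutative then $\mu(x_{i^*})=\overline{\mu(x_i)}$ for every algebra morphism $\mu:H\to\mathbb C$. Put $h_i:=1/N_{i,i^*}^1$. Abelian means $H$ commutative; RN means all structure constants $N_{i,j}^k$ are real and $\ge0$. Let $(H,\mathcal B)$ be abelian. $\widehat{\mathcal B}=\{\mu_1,\dots,\mu_m\}$ is the set of all unital algebra morphisms $H\to\mathbb C$, a basis of $H^*$. An abelian normalizable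 hypergroup $(H,\mathcal B,\mu_1)$ is an abelian hypergroup with a chosen $\mu_1\in\widehat{\mathcal B}$ such that $d_i:=\mu_1(x_i)\neq0$ for all $i$. Dual hypergroup $\widehat{(H,\mathcal B)}=\widehat{(H,\mathcal B,\mu_1)}$: $H^*$ with basis $\widehat{\mathcal B}$, product $(f\star g)(x_i/d_i)=f(x_i/d_i)g(x_i/d_i)$ for all $i$, unit $\mu_1$, involution $\mu_{j^\#}(x_i/d_i)=\mu_j(x_{i^*}/\overline{d_i})$. Write $\mu_i\star\mu_j=\sum_k\widehat p_k(i,j)\mu_k$ and $\widehat h_j:=1/\widehat p_1(j,j^\#)$. Products and squares of the $\mu_j$ are with respect to $\star$. RN for the dual means $\widehat p_k(i,j)\ge0$ for all $i,j,k$. Grouplike elements: $x_i\in\mathcal B$ with $x_ix_{i^*}=N_{i,i^*}^1\,1$. $(H,\mathcal B)$ is Burnside if for every $a\in\mathcal B$: there is $\mu\in\widehat{\mathcal B}$ with $\mu(a)=0$ if and only if $a$ is not grouplike. Adjoint sub-hypergroup of the dual: $\widehat{\mathcal B}_{ad}\subseteq\widehat{\mathcal B}$ is the set of all $\mu_k$ occurring with non-zero coefficient in some power ($n\ge1$, with respect to $\star$) of $\sum_{j}\widehat h_j\,\mu_j\star\mu_{j^\#}$; $\widehat{(H,\mathcal B)}_{ad}$ is its linear span, and its order is $n(\widehat{(H,\mathcal B)}_{ad})=\sum_{\mu_j\in\widehat{\mathcal B}_{ad}}\widehat h_j$. *)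

(* Defs.v *)
From HB Require Import structures.
From mathcomp Require Import all_boot all_order all_algebra all_field.
From mathcomp Require Import boolp reals complex.

Set Implicit Arguments.
Unset Strict Implicit.
Unset Printing Implicit Defensive.

Import Order.TTheory GRing.Theory Num.Theory.

Local Open Scope ring_scope.

(* Coefficient of [x_k] in [x_i * x_j]. *)
Definition struct_const (C : numClosedFieldType) (A : falgType C) (m : nat)
    (x : m.-tuple A) (i j k : 'I_m) : C :=
  coord x k (tnth x i * tnth x j).

(* The rank m is [hg_rank.+1]: H is not the zero ring and the index 1 of the
   unit is [ord0].  In [0 < z], the order of a [numClosedFieldType] makes z
   real and positive. *)
Record hypergroup (C : numClosedFieldType) := Hypergroup {
  hg_alg :> falgType C;
  hg_rank : nat;
  hg_basis : hg_rank.+1.-tuple hg_alg;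
  hg_star : 'I_hg_rank.+1 -> 'I_hg_rank.+1;
  hg_basisP : basis_of fullv hg_basis;
  hg_basis1 : tnth hg_basis ord0 = 1;
  hg_starK : involutive hg_star;
  hg_star_gt0 : forall i, 0 < struct_const hg_basis i (hg_star i) ord0;
  hg_star_eq0 : forall i j, j != hg_star i -> struct_const hg_basis i j ord0 = 0;
  hg_star_anti : forall i j k,
    struct_const hg_basis (hg_star j) (hg_star i) (hg_star k) =
    (struct_const hg_basis i j k)^*
}.

Notation hg_index G := 'I_(hg_rank G).+1.

Section Hypergroups.
Context {C : numClosedFieldType}.
Implicit Type G : hypergroup C.

Definition hg_elt G (i : hg_index G) : G := tnth (hg_basis G) i.

Definition hg_abelian G : Prop := commutative (@GRing.mul G).

Definition hg_dual G := 'Hom(G, C^o).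

Definition hg_char G (f : hg_dual G) : Prop := GRing.monoid_morphism f.

(* [mu] lists the unital algebra morphisms, each once; they are as many as the
   elements of the basis, and the first of them is the chosen [mu_1]. *)
Definition char_enum G (mu : (hg_rank G).+1.-tuple (hg_dual G)) : Prop :=
  uniq mu /\ forall f : hg_dual G, f \in mu <-> hg_char f.

Definition grouplike G (i : hg_index G) : Prop :=
  hg_elt i * hg_elt (hg_star i) =
  (struct_const (hg_basis G) i (hg_star i) ord0)%:A.

Definition burnside G : Prop := forall i : hg_index G,
  (exists2 f : hg_dual G, hg_char f & f (hg_elt i) = 0) <-> ~ grouplike i.

(* The linear form with value [v i] on [x_i]. *)
Definition lin_ext G (v : hg_index G -> C) : hg_dual G :=
  \sum_i (v i : C) *: linfun (coord (hg_basis G) i : G -> C^o).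

Lemma lin_ext_elt G (v : hg_index G -> C) (i : hg_index G) :
  lin_ext v (hg_elt i) = v i.
Proof.
have coordE j : linfun (coord (hg_basis G) j : G -> C^o) (hg_elt i) = (i == j)%:R.
  rewrite lfunE /hg_elt (tnth_nth 0).
  exact: coord_free (basis_free (hg_basisP G)).
rewrite /lin_ext sum_lfunE (bigD1 i) //= big1 => [|j ji].
  by rewrite scale_lfunE coordE eqxx addr0; apply: mulr1.
by rewrite scale_lfunE coordE eq_sym (negbTE ji); apply: mulr0.
Qed.

(* A normalizable hypergroup is one with a character [mu1] that has no zero
   on the basis. *)
Definition normalizable G (mu1 : hg_dual G) : Prop :=
  forall i, mu1 (hg_elt i) != 0.

(* The product and involution of the dual are defined by their values on the
   basis [x_i], see [dual_mulE] and [dual_invE] for the values on [x_i / d_i],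
   where [d_i = mu1 x_i]. *)
Definition dual_mul G (mu1 f g : hg_dual G) : hg_dual G :=
  lin_ext (fun i => let d : C := mu1 (hg_elt i) in
    d * (f (d^-1 *: hg_elt i) * g (d^-1 *: hg_elt i))).

Definition dual_inv G (mu1 f : hg_dual G) : hg_dual G :=
  lin_ext (fun i => let d : C := mu1 (hg_elt i) in
    d * f ((d^*)^-1 *: hg_elt (hg_star i))).

Lemma dual_mulE G (mu1 f g : hg_dual G) (i : hg_index G) :
    normalizable mu1 ->
  let y := (mu1 (hg_elt i) : C)^-1 *: hg_elt i in
  dual_mul mu1 f g y = f y * g y.
Proof.
move=> d0 /=; rewrite [LHS]linearZ /= lin_ext_elt.
by apply: mulKf; apply: d0.
Qed.

Lemma dual_invE G (mu1 f : hg_dual G) (i : hg_index G) :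
    normalizable mu1 ->
  let d : C := mu1 (hg_elt i) in
  dual_inv mu1 f (d^-1 *: hg_elt i) = f ((d^*)^-1 *: hg_elt (hg_star i)).
Proof.
move=> d0 /=; rewrite [LHS]linearZ /= lin_ext_elt.
by apply: mulKf; apply: d0.
Qed.

Definition dual_exp G (mu1 f : hg_dual G) (n : nat) : hg_dual G :=
  iter n (dual_mul mu1 f) mu1.

Section Dual.
Context {G : hypergroup C} (mu : (hg_rank G).+1.-tuple (hg_dual G)).

Let mu1 := tnth mu ord0.

Definition dual_const (i j k : hg_index G) : C :=
  coord mu k (dual_mul mu1 (tnth mu i) (tnth mu j)).

Definition dual_RN : Prop := forall i j k, 0 <= dual_const i j k.

(* [dual_inv mu1 mu_j] is [mu_{j^#}].  No index [j^#] is assumed: when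
   [dual_RN] holds the matrix of [dual_inv mu1] on the [mu_j] is, up to positive
   scalings, orthogonal with nonnegative entries, so it is a permutation. *)
Definition dual_h (j : hg_index G) : C :=
  (coord mu ord0 (dual_mul mu1 (tnth mu j) (dual_inv mu1 (tnth mu j))))^-1.

Definition dual_ad_gen : hg_dual G :=
  \sum_j dual_h j *: dual_mul mu1 (tnth mu j) (dual_inv mu1 (tnth mu j)).

Definition dual_ad : {set hg_index G} :=
  [set k | `[< exists2 n, (0 < n)%N & coord mu k (dual_exp mu1 dual_ad_gen n) != 0 >]].

Definition dual_ad_order : C := \sum_(j in dual_ad) dual_h j.

Definition dual_prod : hg_dual G := \big[dual_mul mu1/mu1]_j tnth mu j.

End Dual.
End Hypergroups.

(* Main.v *)
Require Import Defs.
From mathcomp Require Import all_boot all_order all_algebra all_field.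
From mathcomp Require Import boolp reals complex.
From mathcomp Require Import ring.

(* Evaluating the characters at the normalized basis elements [x_i / d_i] turns
   the dual into the algebra of functions on the index set with pointwise
   product, in which the [mu_j] are orthogonal for the weights [h_i |d_i|^2].
   When the dual is RN, all [|mu_j (x_i / d_i)|] are at most 1, and [x_i] is
   grouplike iff they are all equal to 1.  The generator of the adjoint
   sub-hypergroup is the function proportional to [1 / (h_i |d_i|^2)], which is
   positive and takes the value it has at the unit exactly at the grouplike
   elements; hence their indicator function is a polynomial without constant
   term in the generator, and comparing coefficients it is the right-hand side
   of the identity.  On the left-hand side, the square of the product of the
   [mu_j] is 1 at a grouplike [x_i], since complex conjugation permutes the
   [mu_j], and it vanishes at [x_i] iff some [mu_j] does. *)

Set Implicit Arguments.
Unset Strict Implicit.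
Unset Printing Implicit Defensive.

Import Order.TTheory GRing.Theory Num.Theory.

Local Open Scope ring_scope.

(** * Square tables with weighted orthogonal columns *)

Section WeightedOrthogonality.
Context {C : numClosedFieldType} {m : nat}.
Context (P : 'I_m.+1 -> 'I_m.+1 -> C) (w t : 'I_m.+1 -> C).
Context (w_gt0 : forall i, 0 < w i) (t_gt0 : forall j, 0 < t j).
Context (w0 : w ord0 = 1).
Context (P0l : forall j, P ord0 j = 1) (P0r : forall i, P i ord0 = 1).
Context (orthP : forall j k,
  t j * \sum_i w i * P i k * (P i j)^* = (j == k)%:R).

(** The Fourier coefficient of [v] along column [k] of [P]; the squared norm of that column for the
    weights [w] is the inverse of [t k]. *)
Definition wcoef (v : 'I_m.+1 -> C) k := t k * \sum_i w i * v i * (P i k)^*.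

Lemma eq_wcoef u v : u =1 v -> wcoef u =1 wcoef v.
Proof. by move=> uv k; congr (_ * _); apply: eq_bigr => i _; rewrite uv. Qed.

Lemma wcoef_sum (I : finType) (c : I -> C) (v : I -> 'I_m.+1 -> C) k :
  wcoef (fun i => \sum_a c a * v a i) k = \sum_a c a * wcoef (v a) k.
Proof.
under [RHS]eq_bigr do rewrite mulrCA mulr_sumr.
rewrite -mulr_sumr exchange_big; congr (_ * _); apply: eq_bigr => i _ /=.
by rewrite mulr_sumr mulr_suml; apply: eq_bigr => a _; ring.
Qed.

(** [orthP] makes one square matrix a left inverse of another; it is then a right inverse too, which
    is orthogonality of the rows. *)
Lemma orthP_dual i l : w l * \sum_j t j * P i j * (P l j)^* = (i == l)%:R.
Proof.
pose A := \matrix_(j, i) (t j * w i * (P i j)^*).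
pose B := \matrix_(i, j) P i j.
have AB : A *m B = 1%:M.
  apply/matrixP => j k; rewrite !mxE -orthP mulr_sumr.
  by apply: eq_bigr => a _; rewrite !mxE; ring.
move/mulmx1C/matrixP: AB => /(_ i l); rewrite !mxE => <-.
by rewrite mulr_sumr; apply: eq_bigr => j _; rewrite !mxE; ring.
Qed.

Lemma wcoefK v i : \sum_k wcoef v k * P i k = v i.
Proof.
transitivity (\sum_l v l * (i == l)%:R).
  under [RHS]eq_bigr => l _ do rewrite -orthP_dual 2!mulr_sumr.
  rewrite exchange_big; apply: eq_bigr => k _ /=.
  by rewrite /wcoef mulr_sumr mulr_suml; apply: eq_bigr => l _; ring.
by rewrite (bigD1 i) //= eqxx mulr1 big1 ?addr0 // => l /negbTE li;
   rewrite eq_sym li mulr0.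
Qed.

Lemma wcoefP j k : wcoef (P^~ j) k = (k == j)%:R.
Proof. exact: orthP. Qed.

Definition wgrouplike i := [forall j, `|P i j| == 1].

Definition wdim j := t j / t ord0.

Definition wadj i := \sum_j wdim j * (P i j * (P i j)^*).

Definition wad : {set 'I_m.+1} := [set k |
  `[< exists2 n, (0 < n)%N & wcoef (fun i => wadj i ^+ n) k != 0 >]].

(** * Consequences of nonnegative structure constants *)

Context (RN : forall i j k, 0 <= wcoef (fun l => P l i * P l j) k).

Lemma wcoef_mul_ge0 u v : (forall k, 0 <= wcoef u k) ->
  (forall k, 0 <= wcoef v k) -> forall k, 0 <= wcoef (fun i => u i * v i) k.
Proof.
move=> u0 v0 k.
have -> : wcoef (fun i => u i * v i) k = \sum_(p : 'I_m.+1 * 'I_m.+1)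
    (wcoef u p.1 * wcoef v p.2) * wcoef (fun i => P i p.1 * P i p.2) k.
  rewrite -wcoef_sum; apply: eq_wcoef => i.
  rewrite -{1}(wcoefK u i) -{1}(wcoefK v i) big_distrlr pair_bigA /=.
  by apply: eq_bigr => p _; ring.
by apply: sumr_ge0 => p _; apply: mulr_ge0 (RN _ _ _); apply: mulr_ge0.
Qed.

(** Up to the positive factor [t k / t ord0], this is the conjugate of the coefficient of column
    [ord0] in the product of columns [j] and [k]. *)
Lemma wcoef_conj_ge0 j k : 0 <= wcoef (fun i => (P i j)^*) k.
Proof.
have -> : wcoef (fun i => (P i j)^*) k =
    t k / t ord0 * (wcoef (fun l => P l j * P l k) ord0)^*.
  rewrite /wcoef rmorphM /= (conj_Creal (gtr0_real (t_gt0 _))).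
  rewrite mulrA mulfVK ?gt_eqF // rmorph_sum; congr (_ * _).
  apply: eq_bigr => i _; rewrite P0r rmorph1 mulr1 2!rmorphM /=.
  by rewrite (conj_Creal (gtr0_real (w_gt0 _))) mulrA.
by apply: mulr_ge0; rewrite ?conjC_ge0 // divr_ge0 ?ltW.
Qed.

Lemma sum_wcoef v : \sum_k wcoef v k = v ord0.
Proof. by rewrite -wcoefK; apply: eq_bigr => k _; rewrite P0l mulr1. Qed.

(** Let M be the largest modulus in row [i]. The square of the column where it occurs is a convex
    combination of columns, so M^2 <= M. *)
Lemma norm_table_le1 i j : `|P i j| <= 1.
Proof.
have [/= j0 _ j0_max] := @real_arg_maxP C _ (ord0 : 'I_m.+1) predT
  (fun j => `|P i j|) isT (fun j _ => normr_real _).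
apply: (le_trans (j0_max j isT)).
have [->|Pn0] := eqVneq `|P i j0| 0; first exact: ler01.
have P_gt0 : 0 < `|P i j0| by rewrite lt0r Pn0 normr_ge0.
rewrite -(ler_pM2l P_gt0) mulr1 -normrM.
rewrite -(wcoefK (fun l => P l j0 * P l j0)).
apply: (le_trans (ler_norm_sum _ _ _)).
have -> : `|P i j0| = \sum_k wcoef (fun l => P l j0 * P l j0) k * `|P i j0|.
  by rewrite -mulr_suml sum_wcoef !P0l !mul1r.
apply: ler_sum => k _; rewrite normrM ger0_norm //.
by rewrite ler_wpM2l ?j0_max.
Qed.

(** The matrix [a] of conjugation on the columns is nonnegative, squares to the identity and has row
    sums 1, which makes it a permutation matrix. *)
Lemma conj_table : exists2 s : 'I_m.+1 -> 'I_m.+1,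
  injective s & forall i j, (P i j)^* = P i (s j).
Proof.
pose a j k := wcoef (fun i => (P i j)^*) k.
have aK j l : \sum_k a j k * a k l = (l == j)%:R.
  rewrite -wcoefP -wcoef_sum; apply: eq_wcoef => i.
  rewrite -[in RHS](conjCK (P i j)) -(wcoefK (fun i => (P i j)^*)) rmorph_sum.
  apply: eq_bigr => k _; rewrite rmorphM /=; congr (_ * _).
  by rewrite conj_Creal // ger0_real // wcoef_conj_ge0.
have a_sum j : \sum_k a j k = 1 by rewrite sum_wcoef P0l rmorph1.
have ex j : exists k, [forall i, (P i j)^* == P i k].
  have [k /eqP ak] : exists k, a j k <> 0.
    apply: contrapT => /forallNP a0.
    move/eqP: (a_sum j); rewrite big1 ?(eq_sym 0) ?oner_eq0 // => k _.
    by apply: contrapT; apply: a0.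
  (* The nonnegative terms [a j b * a b l] sum to 0 over [b], so row [k] of [a] is supported at
     [j]. *)
  have akl l : l != j -> a k l = 0.
    move=> /negbTE lj; move/eqP: (aK j l); rewrite lj psumr_eq0 => [|b _].
      by move=> /allP/(_ k (mem_index_enum _)) /=; rewrite mulf_eq0 (negbTE ak) => /eqP.
    by apply: mulr_ge0; apply: wcoef_conj_ge0.
  have akj : a k j = 1.
    by rewrite -(a_sum k) (bigD1 j) //= big1 ?addr0.
  exists k; apply/forallP => i; apply/eqP.
  rewrite -[RHS]conjCK -(wcoefK (fun i => (P i k)^*)) (bigD1 j) //=.
  rewrite -!/(a _ _) akj mul1r big1 ?addr0 // => l lj.
  by rewrite -/(a k l) akl // mul0r.
pose s j := xchoose (ex j).
have sP i j : (P i j)^* = P i (s j).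
  by apply/eqP; move: i; apply/forallP; apply: (xchooseP (ex j)).
exists s => // j k sjk.
have : wcoef (P^~ j) k = wcoef (P^~ k) k.
  by apply: eq_wcoef => i; rewrite -[LHS]conjCK sP sjk -sP conjCK.
by rewrite !wcoefP eqxx; case: eqP => // _ /eqP; rewrite eq_sym oner_eq0.
Qed.

Lemma wadjE i : wadj i = (t ord0 * w i)^-1.
Proof.
have wi := orthP_dual i i; rewrite eqxx in wi.
rewrite invfM -[(w i)^-1]mulr1 -[1]wi mulKf ?gt_eqF // mulr_sumr.
by apply: eq_bigr => j _; rewrite /wdim; ring.
Qed.

Lemma sum_t : \sum_j t j = 1.
Proof.
have := orthP_dual ord0 ord0; rewrite eqxx w0 mul1r => t1; rewrite -[1]t1.
by apply: eq_bigr => j _; rewrite !P0l rmorph1 !mulr1.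
Qed.

(** By [orthP_dual] and [sum_t], [w i - 1] is [w i] times the [t]-weighted sum of the defects
    [1 - |P i j|^2], which are nonnegative by [norm_table_le1]. *)
Lemma wgrouplikeE i : wgrouplike i = (w i == 1).
Proof.
have wi := orthP_dual i i; rewrite eqxx in wi.
have wsum : w i * \sum_j t j * (1 - `|P i j| ^+ 2) = w i - 1.
  under eq_bigr => j _ do rewrite mulrBr mulr1 normCK mulrA.
  by rewrite sumrB sum_t mulrBr mulr1 wi.
apply/forallP/eqP => [Pi1|wi1 j].
  apply/eqP; rewrite -subr_eq0 -wsum big1 ?mulr0 // => j _.
  by rewrite (eqP (Pi1 j)) expr1n subrr mulr0.
move: wsum; rewrite wi1 mul1r subrr => /eqP.
rewrite psumr_eq0 => [|k _]; last first.
  by rewrite mulr_ge0 ?(ltW (t_gt0 _)) // subr_ge0 expr_le1 ?norm_table_le1.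
move=> /allP/(_ j (mem_index_enum _)) /=.
by rewrite mulf_eq0 gt_eqF //= subr_eq0 eq_sym pexpr_eq1.
Qed.

Lemma wadj_grouplike i : (wadj i == wadj ord0) = wgrouplike i.
Proof.
rewrite wgrouplikeE !wadjE (inj_eq invr_inj) w0.
by rewrite (inj_eq (mulfI (lt0r_neq0 (t_gt0 _)))).
Qed.

Lemma wcoef_wadj_exp_ge0 n k : 0 <= wcoef (fun i => wadj i ^+ n) k.
Proof.
elim: n k => [|n IHn] k.
  by rewrite (eq_wcoef (v := P^~ ord0)) ?wcoefP ?ler0n //.
rewrite (eq_wcoef (v := fun i => wadj i * wadj i ^+ n)) => [|i].
  apply: wcoef_mul_ge0 => // l.
  rewrite wcoef_sum sumr_ge0 // => j _; rewrite mulr_ge0 //.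
    by rewrite divr_ge0 ?ltW.
  apply: wcoef_mul_ge0 => b; last exact: wcoef_conj_ge0.
  by rewrite wcoefP ler0n.
by rewrite exprS.
Qed.

(** A power of [wadj] with nonzero coefficient at [j] takes at a grouplike [i] its value at [ord0],
    the sum of its nonnegative coefficients. As [|P i k| <= 1], this is equality in the triangle
    inequality, so every term equals its bound. *)
Lemma table_ad_grouplike i j : j \in wad -> wgrouplike i -> P i j = 1.
Proof.
rewrite inE => /asboolP[n _ cj]; rewrite -wadj_grouplike => /eqP gi.
apply: (mulfI cj); rewrite mulr1.
apply: (@normC_sum_upper C _ predT
  (fun k => wcoef (fun i => wadj i ^+ n) k * P i k)
  (fun k => wcoef (fun i => wadj i ^+ n) k)) => // [k _|].
  by rewrite normrM ger0_norm ?wcoef_wadj_exp_ge0 // ler_piMr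
    ?wcoef_wadj_exp_ge0 ?norm_table_le1.
by rewrite wcoefK sum_wcoef gi.
Qed.

(* The indicator function of the grouplike elements is a polynomial without
   constant term in [wadj], because [wadj] is nonzero and takes the value
   [wadj ord0] exactly there. *)
Lemma wcoef_grouplike_notin j : j \notin wad ->
  wcoef (fun i => (wgrouplike i)%:R) j = 0.
Proof.
move=> jS.
have cj n : wcoef (fun i => wadj i ^+ n.+1) j = 0.
  apply/eqP; apply: contraNT jS => cj; rewrite inE.
  by apply/asboolP; exists n.+1.
(* ['X * q] vanishes at the values of [wadj] off the grouplike elements, and [c] is its value at
   [wadj ord0]; the factor ['X] removes the constant term. *)
pose q := \prod_(i | ~~ wgrouplike i) ('X - (wadj i)%:P).
pose c := wadj ord0 * q.[wadj ord0].
have c_neq0 : c != 0.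
  rewrite mulf_neq0 //; first by rewrite wadjE invr_neq0 // mulf_neq0 ?gt_eqF.
  rewrite horner_prod; apply/prodf_neq0 => i igl.
  by rewrite hornerXsubC subr_eq0 eq_sym wadj_grouplike.
have qE i : wadj i * q.[wadj i] = c * (wgrouplike i)%:R.
  have [igl|igl] := boolP (wgrouplike i).
    by move: (igl); rewrite -wadj_grouplike => /eqP ->; rewrite mulr1.
  rewrite mulr0 horner_prod (bigD1 i) //= hornerXsubC subrr mul0r mulr0 //.
apply: (mulfI c_neq0); rewrite mulr0.
transitivity (\sum_(n < size q) q`_n * wcoef (fun i => wadj i ^+ n.+1) j).
  rewrite -wcoef_sum.
  have := wcoef_sum (fun _ : 'I_1 => c) (fun _ i => (wgrouplike i)%:R) j.
  rewrite big_ord1 => <-; apply: eq_wcoef => i.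
  rewrite big_ord1 -qE horner_coef mulr_sumr; apply: eq_bigr => n _.
  by rewrite exprS mulrCA.
by rewrite big1 // => n _; rewrite cj mulr0.
Qed.

(** For [j] in [wad], grouplike rows have entry 1 and weight 1, so the coefficient of the indicator
    is [N * t j], with [N] the number of grouplike elements; it is 0 for other [j]. Evaluation at
    [ord0] determines [N * t ord0]. *)
Lemma grouplike_indicator i : (wgrouplike i)%:R =
  (\sum_(j in wad) wdim j)^-1 * \sum_(j in wad) wdim j * P i j.
Proof.
pose N : C := \sum_(i | wgrouplike i) 1.
have coefE j : wcoef (fun i => (wgrouplike i)%:R) j =
    if j \in wad then N * t j else 0.
  case: ifPn => [jS|/wcoef_grouplike_notin//].
  rewrite mulrC; congr (_ * _); rewrite [RHS]big_mkcond; apply: eq_bigr => l _.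
  case: ifPn => lgl; last by rewrite mulr0 mul0r.
  rewrite (table_ad_grouplike jS lgl) conjC1 !mulr1.
  by move: lgl; rewrite wgrouplikeE => /eqP.
have ind l : (wgrouplike l)%:R = N * t ord0 * \sum_(j in wad) wdim j * P l j.
  rewrite -(wcoefK (fun i => (wgrouplike i)%:R)) mulr_sumr [RHS]big_mkcond.
  apply: eq_bigr => j _; rewrite coefE; case: ifP => _; last exact: mul0r.
  by rewrite /wdim; field; apply: lt0r_neq0.
have := ind ord0; rewrite wgrouplikeE w0 eqxx.
under eq_bigr do rewrite P0l mulr1.
move=> N1; rewrite ind; congr (_ * _).
have S0 : \sum_(j in wad) wdim j != 0.
  by apply: contra_eq_neq N1 => ->; rewrite mulr0 oner_eq0.
by apply: (mulIf S0); rewrite mulVf.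
Qed.

Lemma prod_table_grouplike i : wgrouplike i -> (\prod_j P i j) ^+ 2 = 1.
Proof.
move=> /forallP igl; have [s s_inj sP] := conj_table.
have conj_prod : (\prod_j P i j)^* = \prod_j P i j.
  rewrite rmorph_prod [RHS](reindex_inj s_inj).
  by apply: eq_bigr => j _; apply: sP.
rewrite expr2 -{2}conj_prod -normCK normr_prod big1 ?expr1n // => j _.
exact/eqP.
Qed.

(** The right-hand side is the indicator of the grouplike elements, where the left-hand side is
    always 1. The identity thus only says that each other row contains a zero. *)
Lemma table_burnside :
  (forall i, (exists j, P i j = 0) <-> ~ wgrouplike i) <->
  (forall i, (\prod_j P i j) ^+ 2 =
     (\sum_(j in wad) wdim j)^-1 * \sum_(j in wad) wdim j * P i j).
Proof.
split=> [bP i|prodP i].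
  rewrite -grouplike_indicator; have [igl|/negP/bP[j Pj0]] := boolP (wgrouplike i).
    exact: prod_table_grouplike.
  by rewrite (bigD1 j) //= Pj0 mul0r expr0n.
split=> [[j Pj0] /forallP/(_ j)|/negP igl].
  by rewrite Pj0 normr0 eq_sym oner_eq0.
have := prodP i; rewrite -grouplike_indicator (negbTE igl) => /eqP.
by rewrite expf_eq0 /= => /prodf_eq0[j _ /eqP]; exists j.
Qed.

End WeightedOrthogonality.

(** * Characters of an abelian hypergroup and their orthogonality *)

Section Characters.
Context {C : numClosedFieldType} {G : hypergroup C}.
Implicit Types (f g : hg_dual G) (i j k : hg_index G) (a b : G).

Local Notation x := (@hg_elt C G).
Local Notation crd := (coord (hg_basis G)).

Definition hg_haar i : C := (struct_const (hg_basis G) i (hg_star i) ord0)^-1.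

(* The values of [f] in [C] instead of the regular module [C^o]. *)
Definition dval f a : C := f a.

Lemma hg_haar_gt0 i : 0 < hg_haar i.
Proof. by rewrite invr_gt0 hg_star_gt0. Qed.

Lemma coord_elt i j : crd j (x i) = (i == j)%:R.
Proof.
by rewrite /hg_elt (tnth_nth 0); apply: coord_free (basis_free (hg_basisP G)).
Qed.

Lemma elt_sum a : a = \sum_i crd i a *: x i.
Proof.
rewrite [LHS](coord_basis (hg_basisP G) (memvf a)).
by apply: eq_bigr => i _; rewrite /hg_elt (tnth_nth 0).
Qed.

Lemma elt0 : x ord0 = 1. Proof. exact: hg_basis1. Qed.

Lemma coord0_mul i j :
  crd ord0 (x i * x j) = (j == hg_star i)%:R / hg_haar i.
Proof.
rewrite invrK; have [->|ji] := eqVneq j (hg_star i); first by rewrite mul1r.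
by rewrite mul0r; apply: hg_star_eq0.
Qed.

Lemma hg_star0 : hg_star ord0 = ord0 :> hg_index G.
Proof.
apply/eqP; apply: contraT => s0.
have := @hg_star_eq0 C G ord0 ord0; rewrite eq_sym => /(_ s0)/eqP.
by rewrite /struct_const -!/(hg_elt _) elt0 mulr1 -elt0 coord_elt oner_eq0.
Qed.

Lemma hg_haar0 : hg_haar ord0 = 1.
Proof.
by rewrite /hg_haar /struct_const hg_star0 -!/(hg_elt _) elt0 mulr1 -elt0
  coord_elt invr1.
Qed.

(** For the bilinear form taking the coefficient of 1 in a product, the basis dual to the [x k]
    consists of the [hg_haar k *: x (hg_star k)]. *)
Lemma coord_haar a k : crd k a = hg_haar k * crd ord0 (a * x (hg_star k)).
Proof.
rewrite [in RHS](elt_sum a) mulr_suml linear_sum (bigD1 k) //=.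
rewrite -scalerAl linearZ /= coord0_mul eqxx big1 ?addr0 => [|i ik].
  by rewrite mul1r mulrCA mulfV ?mulr1 // gt_eqF ?hg_haar_gt0.
rewrite -scalerAl linearZ /= coord0_mul (inj_eq (inv_inj (@hg_starK C G))).
by rewrite eq_sym (negbTE ik) mul0r mulr0.
Qed.

Lemma dval_sum f a : dval f a = \sum_i crd i a * dval f (x i).
Proof.
rewrite /dval [in LHS](elt_sum a) linear_sum.
by apply: eq_bigr => i _; rewrite linearZ.
Qed.

Lemma dvalZ f (c : C) a : dval f (c *: a) = c * dval f a.
Proof. by rewrite /dval linearZ. Qed.

Lemma dval_inj f g : (forall i, dval f (x i) = dval g (x i)) -> f = g.
Proof.
move=> fg; apply/lfunP => a; rewrite -[LHS]/(dval f a) -[RHS]/(dval g a).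
by rewrite !dval_sum; apply: eq_bigr => i _; rewrite fg.
Qed.

Lemma char1 f : hg_char f -> dval f 1 = 1.
Proof. by case. Qed.

Lemma charM f a b : hg_char f -> dval f (a * b) = dval f a * dval f b.
Proof. by case=> _ fM; apply: fM. Qed.

Context (Gab : hg_abelian G).

(** The element representing [f] through the coefficient of 1. For a character it spans a line on
    which the algebra acts by [f]. *)
Definition char_elt f : G := \sum_i (hg_haar i * dval f (x (hg_star i))) *: x i.

Lemma coord0_char_elt f a : crd ord0 (char_elt f * a) = dval f a.
Proof.
rewrite dval_sum [in LHS](elt_sum a) mulr_sumr linear_sum.
apply: eq_bigr => k _; rewrite -scalerAr linearZ /=; congr (_ * _).
rewrite mulr_suml linear_sum (bigD1 (hg_star k)) //= big1 ?addr0.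
  rewrite -scalerAl linearZ /= coord0_mul !hg_starK eqxx mul1r mulrAC.
  by rewrite mulfV ?mul1r // gt_eqF ?hg_haar_gt0.
move=> i ik; rewrite -scalerAl linearZ /= coord0_mul.
have -> : (k == hg_star i) = false.
  by apply: contra_neqF ik => /eqP ->; rewrite hg_starK.
by rewrite mul0r mulr0.
Qed.

Lemma mul_char_elt f a : hg_char f -> a * char_elt f = dval f a *: char_elt f.
Proof.
move=> fc; rewrite [LHS]elt_sum [in RHS]/char_elt scaler_sumr.
apply: eq_bigr => k _; rewrite scalerA; congr (_ *: _).
rewrite coord_haar -mulrA Gab -mulrA coord0_char_elt [x _ * a]Gab.
by rewrite charM // mulrCA.
Qed.

Lemma dval_char_elt f g :
  dval g (char_elt f) = \sum_i hg_haar i * dval f (x (hg_star i)) * dval g (x i).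
Proof.
by rewrite /dval linear_sum; apply: eq_bigr => i _; rewrite linearZ.
Qed.

(** Applying [g] to [x i * char_elt f], a multiple of [char_elt f] by [f (x i)], shows that a
    nonzero [g (char_elt f)] would cancel and give [f = g]. *)
Lemma char_elt_orth f g : hg_char f -> hg_char g -> f != g ->
  dval g (char_elt f) = 0.
Proof.
move=> fc gc fg; apply/eqP; apply: contraNT fg => gf; apply/eqP/dval_inj => i.
apply: (mulIf gf).
by rewrite -dvalZ -mul_char_elt // charM.
Qed.

Definition char_conj f : hg_dual G := lin_ext (fun i => (dval f (x (hg_star i)))^*).

Lemma dval_char_conj f i : dval (char_conj f) (x i) = (dval f (x (hg_star i)))^*.
Proof. exact: lin_ext_elt. Qed.

(** [hg_star_anti] conjugates the structure constants and reverses the factors; the reversal is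
    harmless since values commute in [C]. *)
Lemma char_conjP f : hg_char f -> hg_char (char_conj f).
Proof.
move=> fc; have f1 : dval (char_conj f) 1 = 1.
  by rewrite -elt0 dval_char_conj hg_star0 elt0 char1 ?conjC1.
have fM a b : dval (char_conj f) (a * b) = dval (char_conj f) a * dval (char_conj f) b.
  have fMx i j : dval (char_conj f) (x i * x j) =
      dval (char_conj f) (x i) * dval (char_conj f) (x j).
    rewrite !dval_char_conj -rmorphM /= mulrC -charM //.
    rewrite dval_sum [in RHS]dval_sum rmorph_sum /=.
    rewrite [RHS](reindex_inj (inv_inj (@hg_starK C G))).
    apply: eq_bigr => k _; rewrite rmorphM /= dval_char_conj; congr (_ * _).
    have := hg_star_anti i j k; rewrite /struct_const -!/(hg_elt _) => ->.
    by rewrite conjCK.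
  rewrite [a]elt_sum [b]elt_sum mulr_suml /dval !linear_sum /= mulr_suml.
  apply: eq_bigr => i _; rewrite mulr_sumr linear_sum /= mulr_sumr.
  apply: eq_bigr => j _; rewrite -scalerAl -scalerAr !linearZ /=.
  have := fMx i j; rewrite /dval => ->.
  have mulE (c d u v : C) : c * (d * (u * v)) = c * u * (d * v) by ring.
  exact: mulE.
by split.
Qed.

(* Otherwise [f] and [char_conj f] would be distinct characters, and
   orthogonality would make a sum of squared moduli vanish. *)
Lemma dval_star f i : hg_char f -> dval f (x (hg_star i)) = (dval f (x i))^*.
Proof.
move=> fc; suff fE : char_conj f = f by rewrite -[in LHS]fE dval_char_conj hg_starK.
apply/eqP; rewrite eq_sym; apply: contraT.
move=> /(char_elt_orth fc (char_conjP fc))/eqP.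
rewrite dval_char_elt psumr_eq0 => [|k _].
  move/allP/(_ ord0 (mem_index_enum _)); rewrite dval_char_conj hg_star0 elt0.
  by rewrite char1 // conjC1 !mulr1 hg_haar0 oner_eq0.
rewrite dval_char_conj -mulrA -normCK.
by apply: mulr_ge0; rewrite ?exprn_ge0 // ltW ?hg_haar_gt0.
Qed.

Lemma char_orth f g : hg_char f -> hg_char g -> f != g ->
  \sum_i hg_haar i * dval g (x i) * (dval f (x i))^* = 0.
Proof.
move=> fc gc fg; rewrite -[RHS](char_elt_orth fc gc fg) dval_char_elt.
by apply: eq_bigr => i _; rewrite dval_star // mulrAC.
Qed.

End Characters.

(** * The dual as functions on the index set with pointwise product *)

Section DualTable.
Context {C : numClosedFieldType} {G : hypergroup C}.
Context (mu : (hg_rank G).+1.-tuple (hg_dual G)).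
Context (Gab : hg_abelian G) (muP : char_enum mu).
Context (mu1_neq0 : normalizable (tnth mu ord0)).

Local Notation x := (@hg_elt C G).
Local Notation mu1 := (tnth mu ord0).
Local Notation d i := (dval mu1 (x i)).

Definition nval (f : hg_dual G) i : C := dval f (x i) / d i.

Definition char_table i j : C := nval (tnth mu j) i.

(** The factor [|d i|^2] undoes the normalization in [nval], see [weight_nval]. *)
Definition table_weight i : C := hg_haar i * `|d i| ^+ 2.

Definition plancherel j : C :=
  (\sum_i hg_haar i * `|dval (tnth mu j) (x i)| ^+ 2)^-1.

Local Notation P := char_table.
Local Notation w := table_weight.
Local Notation t := plancherel.

Lemma mu_char j : hg_char (tnth mu j).
Proof. by case: muP => _ muc; apply/muc/mem_tnth. Qed.

Lemma d_neq0 i : d i != 0. Proof. exact: mu1_neq0. Qed.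

Lemma table_weight_gt0 i : 0 < w i.
Proof. by rewrite mulr_gt0 ?hg_haar_gt0 // exprn_gt0 // normr_gt0 d_neq0. Qed.

Lemma table_weight0 : w ord0 = 1.
Proof.
by rewrite /w hg_haar0 elt0 char1 ?normr1 ?expr1n ?mulr1 //; apply: mu_char.
Qed.

Lemma plancherel_gt0 j : 0 < t j.
Proof.
rewrite invr_gt0 (bigD1 ord0) //= elt0 char1; last exact: mu_char.
rewrite normr1 expr1n mulr1 ltr_pwDl ?hg_haar_gt0 // sumr_ge0 // => i _.
by apply: mulr_ge0; rewrite ?exprn_ge0 // ltW ?hg_haar_gt0.
Qed.

Lemma char_table0l j : P ord0 j = 1.
Proof. by rewrite /P /nval elt0 !char1 ?divr1 //; apply: mu_char. Qed.

Lemma char_table0r i : P i ord0 = 1.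
Proof. by rewrite /P /nval divff // d_neq0. Qed.

Lemma weight_nval f g i :
  w i * nval f i * (nval g i)^* = hg_haar i * dval f (x i) * (dval g (x i))^*.
Proof.
rewrite /w /nval normCK rmorphM fmorphV /=; have d0 := d_neq0 i.
by field; rewrite d0 /= conjC_eq0 d0.
Qed.

Lemma char_table_orth j k :
  t j * \sum_i w i * P i k * (P i j)^* = (j == k)%:R.
Proof.
under eq_bigr do rewrite weight_nval.
have [<-|jk] := eqVneq j k; last first.
  rewrite char_orth ?mulr0 //; try exact: mu_char.
  by case: muP => mu_uniq _; rewrite !(tnth_nth 0) nth_uniq ?size_tuple.
under eq_bigr => i _ do rewrite -mulrA -normCK.
by rewrite mulVf // -invr_eq0 gt_eqF ?plancherel_gt0.
Qed.

Local Notation coef := (wcoef P w t).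

Lemma nval_inj f g : nval f =1 nval g -> f = g.
Proof.
move=> fg; apply: dval_inj => i.
by apply: (mulIf (invr_neq0 (d_neq0 i))); apply: fg.
Qed.

Lemma nval_sum (I : finType) (A : pred I) (c : I -> C) (f : I -> hg_dual G) i :
  nval (\sum_(a | A a) c a *: f a) i = \sum_(a | A a) c a * nval (f a) i.
Proof.
rewrite /nval /dval sum_lfunE mulr_suml; apply: eq_bigr => a _.
by rewrite scale_lfunE mulrA.
Qed.

Lemma nvalZ (c : C) f i : nval (c *: f) i = c * nval f i.
Proof. by rewrite /nval /dval scale_lfunE mulrA. Qed.

Lemma dual_sum f : f = \sum_k coef (nval f) k *: tnth mu k.
Proof.
apply: nval_inj => i; rewrite nval_sum.
by rewrite -[LHS](wcoefK char_table_orth (nval f)).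
Qed.

(** The coefficients of a vanishing combination are the Fourier coefficients of the zero
    function. *)
Lemma free_mu : free mu.
Proof.
apply/freeP => c c0 k.
have -> : c k = \sum_j c j * coef (P^~ j) k.
  rewrite (bigD1 k) //= (wcoefP char_table_orth) eqxx mulr1 big1 ?addr0 //.
  by move=> j jk; rewrite (wcoefP char_table_orth) eq_sym (negbTE jk) mulr0.
rewrite -wcoef_sum /wcoef big1 ?mulr0 // => i _.
suff -> : \sum_j c j * P i j = 0 by rewrite mulr0 mul0r.
transitivity (nval 0 i); last by rewrite /nval /dval zero_lfunE mul0r.
by rewrite -c0 nval_sum; apply: eq_bigr => j _; rewrite /P (tnth_nth 0).
Qed.

Lemma coord_dual f k : coord mu k f = coef (nval f) k.
Proof.
rewrite [in LHS](dual_sum f) -(coord_sum_free (coef (nval f)) k free_mu).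
by congr (coord _ _ _); apply: eq_bigr => j _; rewrite (tnth_nth 0).
Qed.

Lemma nval_mul f g i : nval (dual_mul mu1 f g) i = nval f i * nval g i.
Proof.
rewrite {1}/nval /dual_mul /dval lin_ext_elt -!/(dval _ _) !dvalZ.
by rewrite mulrC mulKf ?d_neq0 // ![_^-1 * _]mulrC.
Qed.

Lemma nval_one i : nval mu1 i = 1.
Proof. exact: char_table0r. Qed.

Lemma nval_exp f n i : nval (dual_exp mu1 f n) i = nval f i ^+ n.
Proof.
elim: n => [|n IHn]; first exact: nval_one.
by rewrite exprS -IHn -nval_mul.
Qed.

Lemma nval_prod i : nval (dual_prod mu) i = \prod_j P i j.
Proof.
by apply: (big_morph (nval^~ i)) => [f g|]; [apply: nval_mul|apply: nval_one].
Qed.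

Lemma nval_inv j i : nval (dual_inv mu1 (tnth mu j)) i = (P i j)^*.
Proof.
rewrite {1}/nval /dual_inv /dval lin_ext_elt -!/(dval _ _) dvalZ.
rewrite mulrC mulKf ?d_neq0 // dval_star //; last exact: mu_char.
by rewrite /P /nval rmorphM fmorphV /= mulrC.
Qed.

(** The coefficient of [mu1] in the product of [mu_j] and its dual inverse is [t ord0] times the
    squared norm of [mu_j], that is [t ord0 / t j]. *)
Lemma dual_hE j : dual_h mu j = wdim t j.
Proof.
rewrite /dual_h coord_dual /wcoef /wdim.
have -> : \sum_i w i * nval (dual_mul mu1 (tnth mu j) (dual_inv mu1 (tnth mu j))) i
    * (P i ord0)^* = (t j)^-1.
  have := char_table_orth j j; rewrite eqxx.
  move=> /(canRL (mulKf (lt0r_neq0 (plancherel_gt0 j)))); rewrite mulr1 => <-.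
  apply: eq_bigr => i _; rewrite nval_mul nval_inv char_table0r conjC1 mulr1.
  by rewrite mulrA.
exact: invf_div.
Qed.

Lemma nval_ad_gen i : nval (dual_ad_gen mu) i = wadj P t i.
Proof.
rewrite nval_sum; apply: eq_bigr => j _.
by rewrite dual_hE nval_mul nval_inv.
Qed.

Lemma dual_adE : dual_ad mu = wad P w t.
Proof.
apply/setP => k; rewrite !inE; congr (`[< _ >]).
congr (exists2 n, _ & _); apply/funext => n.
rewrite coord_dual; congr (is_true (_ != 0)); apply: eq_wcoef => i.
by rewrite nval_exp nval_ad_gen.
Qed.

(** By [dual_sum] each coordinate form is a linear combination of characters. *)
Lemma char_separate a b :
  (forall j, dval (tnth mu j) a = dval (tnth mu j) b) -> a = b.
Proof.
move=> ab; rewrite [a]elt_sum [b]elt_sum; apply: eq_bigr => k _.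
congr (_ *: _); pose f := linfun (coord (hg_basis G) k : G -> C^o).
have fE c : coord (hg_basis G) k c =
    \sum_j coef (nval f) j * dval (tnth mu j) c.
  transitivity (dval f c); first by rewrite /dval lfunE.
  rewrite {1}(dual_sum f) /dval sum_lfunE; apply: eq_bigr => j _.
  by rewrite scale_lfunE.
by rewrite !fE; apply: eq_bigr => j _; rewrite ab.
Qed.

(** The [j]-th character takes the value [|d i|^2 * |P i j|^2] on [x i * x (hg_star i)]. This
    product is scalar iff that value is independent of [j], and column [ord0] has entries 1. *)
Lemma grouplikeE i : grouplike i <-> wgrouplike P i.
Proof.
have norm_mul j : dval (tnth mu j) (x i * x (hg_star i)) =
    `|d i| ^+ 2 * `|P i j| ^+ 2.
  have muc := mu_char j; rewrite charM // (dval_star Gab) //.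
  rewrite -normCK -exprMn -normrM; congr (`|_| ^+ 2).
  by rewrite /P /nval mulrC mulfVK ?d_neq0.
have dd_neq0 : `|d i| ^+ 2 != 0 by rewrite expf_neq0 // normr_eq0 d_neq0.
split=> [gl|/forallP gl].
  apply/forallP => j.
  have val j' : `|d i| ^+ 2 * `|P i j'| ^+ 2 = (hg_haar i)^-1.
    rewrite -norm_mul gl dvalZ char1 ?mulr1 ?invrK //; exact: mu_char.
  have := val ord0; rewrite char_table0r normr1 expr1n mulr1 => di.
  have := val j; rewrite -di -[RHS]mulr1 => /(mulfI dd_neq0)/eqP.
  by rewrite pexpr_eq1.
have E : x i * x (hg_star i) = (`|d i| ^+ 2)%:A.
  apply: char_separate => j; rewrite norm_mul dvalZ char1; last exact: mu_char.
  by rewrite (eqP (gl j)) expr1n.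
(* Reading off the coefficient of 1 identifies [|d i|^2] with the structure constant. *)
rewrite /grouplike E; congr (_ *: _).
rewrite /struct_const -!/(hg_elt _) E linearZ /= -elt0 coord_elt.
by rewrite eqxx mulr1.
Qed.

End DualTable.

Theorem theorem1p8 (R : realType) (G : hypergroup R[i])
    (mu : (hg_rank G).+1.-tuple (hg_dual G)) :
  hg_abelian G ->
  char_enum mu ->
  normalizable (tnth mu ord0) ->
  dual_RN mu ->
  burnside G <->
  dual_exp (tnth mu ord0) (dual_prod mu) 2%N =
    (dual_ad_order mu)^-1 *: (\sum_(j in dual_ad mu) dual_h mu j *: tnth mu j).
Proof.
move=> Gab muP mu1_neq0 muRN.
set P := char_table mu; set w := table_weight mu; set t := plancherel mu.
have RN i j k : 0 <= wcoef P w t (fun l => P l i * P l j) k.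
  have := muRN i j k; rewrite /dual_const (coord_dual Gab muP mu1_neq0).
  by rewrite (eq_wcoef _ _ _ (nval_mul mu1_neq0 _ _)).
have := table_burnside (table_weight_gt0 mu1_neq0) (plancherel_gt0 muP)
  (table_weight0 muP) (char_table0l muP) (char_table0r mu1_neq0)
  (char_table_orth Gab muP mu1_neq0) RN.
have -> : burnside G <->
    (forall i, (exists j, P i j = 0) <-> ~ wgrouplike P i).
  have zeroE i : (exists2 f : hg_dual G, hg_char f & f (hg_elt i) = 0) <->
      (exists j, P i j = 0).
    split=> [[f fc fi0]|[j /eqP]].
      have /tnthP[j fj] : f \in mu by case: muP => _ ->.
      by exists j; rewrite /P /char_table /nval -fj /dval fi0 mul0r.
    rewrite mulf_eq0 invr_eq0 (negbTE (d_neq0 mu1_neq0 i)) orbF => /eqP fi0.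
    by exists (tnth mu j) => //; apply: (mu_char muP).
  by split=> H i; have := H i; rewrite zeroE (grouplikeE Gab muP mu1_neq0).
have nval_rhs i : nval mu ((dual_ad_order mu)^-1 *:
      (\sum_(j in dual_ad mu) dual_h mu j *: tnth mu j)) i =
    (\sum_(j in wad P w t) wdim t j)^-1 *
      \sum_(j in wad P w t) wdim t j * P i j.
  rewrite nvalZ nval_sum /dual_ad_order (dual_adE Gab muP mu1_neq0).
  by congr (_^-1 * _); apply: eq_bigr => j _; rewrite (dual_hE Gab muP mu1_neq0).
have nval_lhs i : nval mu (dual_exp (tnth mu ord0) (dual_prod mu) 2) i =
    (\prod_j P i j) ^+ 2.
  by rewrite nval_exp // nval_prod.
(* Both sides of the identity are compared through their normalized values, which determine an
   element of the dual. *)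
move=> ->; split=> [E|E i]; last by rewrite -nval_lhs E nval_rhs.
by apply: (nval_inj mu1_neq0) => i; rewrite nval_lhs E nval_rhs.
Qed.
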